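(* Let $N\ge 1$ and let $I_1,\dots,I_N$ be positive integers; put $J_m=I_m$ for $m=1,\dots,N$. Let $\widetilde{\mathbb{T}}=\{\mathcal{T}\in\mathbb{R}^{I_1\times\cdots\times I_N\times J_1\times\cdots\times J_N}:\det(f(\mathcal{T}))\neq 0\}$, where $f$ is the matricization map. Then $(\widetilde{\mathbb{T}},\ast_N)$, where $\ast_N$ is the Einstein product, is a group.
   Context: The matricization map $f:\mathbb{R}^{I_1\times\cdots\times I_N\times J_1\times\cdots\times J_N}\to\mathbb{R}^{(I_1\cdots I_N)\times(J_1\cdots J_N)}$ is defined entrywise by $$(f(\mathcal{A}))_{\left[i_1+\sum_{k=2}^{N}(i_k-1)\prod_{l=1}^{k-1}I_l\right],\left[j_1+\sum_{k=2}^{N}(j_k-1)\prod_{l=1}^{k-1}J_l\right]}=a_{i_1\ldots i_Nj_1\ldots j_N}.$$ The Einstein product $\ast_N$ of $\mathcal{A},\mathcal{B}\in\mathbb{R}^{I_1\times\cdots\times I_N\times I_1\times\cdots\times I_N}$ is $$(\mathcal{A}\ast_N\mathcal{B})_{i_1\ldots i_Nj_1\ldots j_N}=\sum_{k_1,\ldots,k_N}a_{i_1\ldots i_Nk_1\ldots k_N}\,b_{k_1\ldots k_Nj_1\ldots j_N}.$$ *)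

(* Defs.v *)
From HB Require Import structures.
From mathcomp Require Import all_boot all_order all_algebra.
From mathcomp Require Import reals.

Set Implicit Arguments.
Unset Strict Implicit.
Unset Printing Implicit Defensive.

Import Order.TTheory GRing.Theory Num.Theory.

Section MultiIndex.

Variables (N : nat) (I : 'I_N -> nat).

(* Multi-indices (i_1, ..., i_N), with every component counted from 0. *)
Definition mindex : finType := {dffun forall m : 'I_N, 'I_(I m)}.

Implicit Types i j : mindex.

(* i_1 + \sum_(k = 2 .. N) (i_k - 1) \prod_(l = 1 .. k - 1) I_l, shifted to
   start from 0. The term for the first component has an empty product, so it
   needs no separate treatment. *)
Definition rank_nat i : nat :=
  \sum_(k < N) i k * \prod_(l < N | l < k) I l.

Let psum i n := \sum_(k < N | k < n) i k * \prod_(l < N | l < k) I l.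
Let pprod n := \prod_(l < N | l < n) I l.

Let psumS i n (ltnN : n < N) :
  psum i n.+1 = i (Ordinal ltnN) * pprod n + psum i n.
Proof.
rewrite /psum (bigD1 (Ordinal ltnN)) //=; congr (_ + _).
by apply: eq_bigl => k; rewrite -val_eqE /= ltnS ltn_neqAle andbC.
Qed.

Let pprodS n (ltnN : n < N) : pprod n.+1 = I (Ordinal ltnN) * pprod n.
Proof.
rewrite /pprod (bigD1 (Ordinal ltnN)) //=; congr (_ * _).
by apply: eq_bigl => k; rewrite -val_eqE /= ltnS ltn_neqAle andbC.
Qed.

Let psum_lt i n : n <= N -> psum i n < pprod n.
Proof.
elim: n => [|n IHn] ltnN; first by rewrite /psum /pprod !big_pred0.
rewrite (psumS i ltnN) (pprodS ltnN).
have lt_iI := ltn_ord (i (Ordinal ltnN)).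
apply: (@leq_trans ((i (Ordinal ltnN)).+1 * pprod n)).
  by rewrite mulSn addnC ltn_add2r IHn // ltnW.
by rewrite leq_mul2r lt_iI orbT.
Qed.

Let rank_psum i : rank_nat i = psum i N.
Proof. by apply: eq_bigl => k; rewrite ltn_ord. Qed.

Lemma rank_proof i : rank_nat i < \prod_(m < N) I m.
Proof.
have -> : \prod_(m < N) I m = pprod N.
  by apply: eq_bigl => k; rewrite ltn_ord.
by rewrite rank_psum psum_lt.
Qed.

Definition rank i : 'I_(\prod_(m < N) I m) := Ordinal (rank_proof i).

Lemma rank_inj : injective rank.
Proof.
move=> i j /(congr1 val) /=; rewrite !rank_psum => eq_ij.
suff eq_psum n : n <= N -> psum i n = psum j n ->
    forall k : 'I_N, k < n -> i k = j k.
  by apply/ffunP => k; apply: (eq_psum N).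
elim: n => [|n IHn] // ltnN.
rewrite !(psumS _ ltnN) => eqS k.
have lti := psum_lt i (ltnW ltnN); have ltj := psum_lt j (ltnW ltnN).
have p_gt0 : 0 < pprod n by apply: leq_ltn_trans lti.
have eqn : psum i n = psum j n.
  by have := congr1 (modn^~ (pprod n)) eqS; rewrite /= !modnMDl !modn_small.
rewrite ltnS leq_eqVlt => /orP[/eqP def_k | ltkn]; last first.
  exact: IHn (ltnW ltnN) eqn k ltkn.
have -> : k = Ordinal ltnN by apply: val_inj.
apply: val_inj; have := congr1 (divn^~ (pprod n)) eqS.
by rewrite /= !divnMDl // !divn_small // !addn0.
Qed.

Lemma card_mindex : #|mindex| = \prod_(m < N) I m.
Proof.
rewrite card_dep_ffun foldrE big_image /=.
by apply: eq_bigr => m _; rewrite card_ord.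
Qed.

Lemma rank_codom p : p \in codom rank.
Proof. by apply: inj_card_onto rank_inj _ p; rewrite card_ord card_mindex. Qed.

Definition unrank (p : 'I_(\prod_(m < N) I m)) : mindex := iinv (rank_codom p).

Lemma unrankK : cancel unrank rank.
Proof. by move=> p; apply: f_iinv. Qed.

Lemma rankK : cancel rank unrank.
Proof. by move=> i; apply: rank_inj; rewrite unrankK. Qed.

End MultiIndex.

Definition tensor (R : Type) (N : nat) (I J : 'I_N -> nat) :=
  {ffun mindex I * mindex J -> R}.

Definition matricize (R : Type) (N : nat) (I J : 'I_N -> nat)
    (A : tensor R I J) : 'M[R]_(\prod_(m < N) I m, \prod_(m < N) J m) :=
  \matrix_(p, q) A (unrank p, unrank q).

(* As rank is a bijection, this entrywise equation determines matricize A. *)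
Lemma matricizeE (R : Type) (N : nat) (I J : 'I_N -> nat) (A : tensor R I J)
    (i : mindex I) (j : mindex J) :
  matricize A (rank i) (rank j) = A (i, j).
Proof. by rewrite mxE !rankK. Qed.

Definition einstein (R : realType) (N : nat) (I : 'I_N -> nat)
    (A B : tensor R I I) : tensor R I I :=
  [ffun ij => \sum_(k : mindex I) A (ij.1, k) * B (k, ij.2)]%R.

Definition nonsingular_tensor (R : realType) (N : nat) (I : 'I_N -> nat) :
    {pred tensor R I I} :=
  [pred T | \det (matricize T) != 0]%R.

(* The set A with the operation op is a group: the subtype of the elements of A
   has a group structure whose product is the restriction of op. In particular
   A is closed under op. *)
Definition is_group (T : Type) (A : {pred T}) (op : T -> T -> T) : Prop :=
  exists G : monoid.Group {x : T | x \in A},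
    forall x y : monoid.Group.Pack G,
      sval (x * y)%g = op (sval x) (sval y).

(* Main.v *)
(* The matricization f is a bijection from tensors onto square matrices that
   turns the Einstein product into the matrix product, so the group structure is
   that of the invertible matrices, transported along f. *)
Require Import Defs.
From HB Require Import structures.
From mathcomp Require Import all_boot all_order all_algebra.
From mathcomp Require Import reals.

Import GRing.Theory.

Definition tensorize (R : Type) (N : nat) (I J : 'I_N -> nat)
    (M : 'M[R]_(\prod_(m < N) I m, \prod_(m < N) J m)) : tensor R I J :=
  [ffun ij => M (rank ij.1) (rank ij.2)].

Lemma matricizeK (R : Type) (N : nat) (I J : 'I_N -> nat) :
  cancel (@matricize R N I J) (@tensorize R N I J).
Proof. by move=> A; apply/ffunP=> -[i j]; rewrite ffunE matricizeE. Qed.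

Lemma tensorizeK (R : Type) (N : nat) (I J : 'I_N -> nat) :
  cancel (@tensorize R N I J) (@matricize R N I J).
Proof. by move=> M; apply/matrixP=> p q; rewrite mxE ffunE /= !unrankK. Qed.

Section NonsingularTensors.

Variables (R : realType) (N : nat) (I : 'I_N -> nat).

Local Open Scope ring_scope.

(** Both products sum over a middle index, a multi-index on one side and its rank on the other; the
    numbering of multi-indices is a bijection, so the two sums have the same terms. *)
Lemma matricize_einstein (A B : tensor R I I) :
  matricize (einstein A B) = matricize A *m matricize B.
Proof.
apply/matrixP=> p q; rewrite !mxE ffunE /=.
rewrite (reindex (@unrank N I)) /=; last first.
  by exists (@rank N I) => ? _; [apply: unrankK | apply: rankK].
by apply: eq_bigr => k _; rewrite !mxE.
Qed.

(** In a field the units are the nonzero elements, so the closure properties of [unitmx] become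
    available for tensors. *)
Lemma nonsingular_tensorE (A : tensor R I I) :
  (A \in @nonsingular_tensor R N I) = (matricize A \in unitmx).
Proof. by rewrite inE unitmxE unitfE. Qed.

Lemma nonsingular_tensorize (M : 'M[R]_(\prod_(m < N) I m)) :
  (tensorize R N I I M \in @nonsingular_tensor R N I) = (M \in unitmx).
Proof. by rewrite nonsingular_tensorE tensorizeK. Qed.

Definition nonsingular : Type :=
  {A : tensor R I I | A \in @nonsingular_tensor R N I}.

(** A group structure is built over a choice type; the one on the subtype is registered here under
    its new name. *)
HB.instance Definition _ := Choice.on nonsingular.

Definition nonsingular_mx (x : nonsingular) : 'M[R]_(\prod_(m < N) I m) :=
  matricize (sval x).

(** Reduces each group law to an identity between matrices. Membership is a boolean condition, so
    the subtype projection is injective, and [matricize] has a left inverse. *)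
Lemma nonsingular_mx_inj : injective nonsingular_mx.
Proof. by move=> x y /(can_inj (@matricizeK R N I I))/val_inj. Qed.

Lemma nonsingular_mx_unit (x : nonsingular) : nonsingular_mx x \in unitmx.
Proof. by rewrite -nonsingular_tensorE (valP x). Qed.

Fact one_subproof :
  tensorize R N I I 1%:M \in @nonsingular_tensor R N I.
Proof. by rewrite nonsingular_tensorize unitmx1. Qed.

Fact inv_subproof (x : nonsingular) :
  tensorize R N I I (invmx (nonsingular_mx x)) \in @nonsingular_tensor R N I.
Proof. by rewrite nonsingular_tensorize unitmx_inv nonsingular_mx_unit. Qed.

Fact mul_subproof (x y : nonsingular) :
  einstein (sval x) (sval y) \in @nonsingular_tensor R N I.
Proof.
by rewrite nonsingular_tensorE matricize_einstein unitmx_mul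
  !nonsingular_mx_unit.
Qed.

Definition nonsingular_one : nonsingular :=
  exist (fun A => A \in @nonsingular_tensor R N I) _ one_subproof.

Definition nonsingular_inv (x : nonsingular) : nonsingular :=
  exist (fun A => A \in @nonsingular_tensor R N I) _ (inv_subproof x).

Definition nonsingular_mul (x y : nonsingular) : nonsingular :=
  exist (fun A => A \in @nonsingular_tensor R N I) _ (mul_subproof x y).

Lemma nonsingular_mx1 : nonsingular_mx nonsingular_one = 1%:M.
Proof. exact: tensorizeK. Qed.

Lemma nonsingular_mxV (x : nonsingular) :
  nonsingular_mx (nonsingular_inv x) = invmx (nonsingular_mx x).
Proof. exact: tensorizeK. Qed.

Lemma nonsingular_mxM (x y : nonsingular) :
  nonsingular_mx (nonsingular_mul x y) = nonsingular_mx x *m nonsingular_mx y.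
Proof. exact: matricize_einstein. Qed.

Fact nonsingular_mulA : associative nonsingular_mul.
Proof.
by move=> x y z; apply: nonsingular_mx_inj; rewrite !nonsingular_mxM mulmxA.
Qed.

Fact nonsingular_mul1 : left_id nonsingular_one nonsingular_mul.
Proof.
move=> x; apply: nonsingular_mx_inj.
by rewrite nonsingular_mxM nonsingular_mx1 mul1mx.
Qed.

Fact nonsingular_mulr1 : right_id nonsingular_one nonsingular_mul.
Proof.
move=> x; apply: nonsingular_mx_inj.
by rewrite nonsingular_mxM nonsingular_mx1 mulmx1.
Qed.

Fact nonsingular_mulV :
  left_inverse nonsingular_one nonsingular_inv nonsingular_mul.
Proof.
move=> x; apply: nonsingular_mx_inj; rewrite nonsingular_mxM nonsingular_mxV.
(* [invmx] returns its argument on a singular matrix, so the cancellation requires invertibility. *)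
by rewrite nonsingular_mx1 mulVmx ?nonsingular_mx_unit.
Qed.

Fact nonsingular_mulrV :
  right_inverse nonsingular_one nonsingular_inv nonsingular_mul.
Proof.
move=> x; apply: nonsingular_mx_inj; rewrite nonsingular_mxM nonsingular_mxV.
by rewrite nonsingular_mx1 mulmxV ?nonsingular_mx_unit.
Qed.

HB.instance Definition _ := isGroup.Build nonsingular nonsingular_mulA
  nonsingular_mul1 nonsingular_mulr1 nonsingular_mulV nonsingular_mulrV.

End NonsingularTensors.

Theorem corollary3p6 (R : realType) (N : nat) (I : 'I_N -> nat)
    (hN : 1 <= N) (hI : forall m : 'I_N, 0 < I m) :
  is_group (@nonsingular_tensor R N I) (@einstein R N I).
(* [nonsingular] unfolds to the subtype in [is_group], and the first component of
   [nonsingular_mul x y] is the Einstein product by computation, so the required equation holds by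
   conversion. *)
Proof. by exists (Group.on (nonsingular R N I)). Qed.
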